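(* Define $\hat\Phi:\mathcal P(\mathcal Q(\mathcal T))\to\mathcal P(\hat{\mathbf E}_{\mathrm{fin}})$ by $\hat\Phi(F):=\{E(\mathcal V):\mathcal V\subseteq F,\ \mathcal V\text{ finite}\}$ and $\hat\Delta:\mathcal P(\hat{\mathbf E}_{\mathrm{fin}})\to\mathcal P(\mathcal Q(\mathcal T))$ by $\hat\Delta(\mathcal F):=\{A\in\mathcal Q(\mathcal T):\overline{\mathbf D}_A\in\mathcal F\}$. Then for all SDFSes $F,F_1,F_2\subseteq\mathcal Q(\mathcal T)$ and all $\mathcal F,\mathcal F_1,\mathcal F_2\subseteq\hat{\mathbf E}_{\mathrm{fin}}$: (i) if $F$ is a finitely coherent SDFS then $\hat\Phi(F)$ is a proper filter on $(\hat{\mathbf E}_{\mathrm{fin}},\subseteq)$; (ii) if $\mathcal F$ is a proper filter on $(\hat{\mathbf E}_{\mathrm{fin}},\subseteq)$ then $\hat\Delta(\mathcal F)$ is a finitely coherent SDFS; (iii) if $F$ is a finitely coherent SDFS then $\hat\Delta(\hat\Phi(F))=F$; (iv) if $\mathcal F$ is a proper filter on $(\hat{\mathbf E}_{\mathrm{fin}},\subseteq)$ then $\hat\Phi(\hat\Delta(\mathcal F))=\mathcal F$; (v) if $F_1\subseteq F_2$ then $\hat\Phi(F_1)\subseteq\hat\Phi(F_2)$; (vi) if $\mathcal F_1\subseteq\mathcal F_2$ then $\hat\Delta(\mathcal F_1)\subseteq\hat\Delta(\mathcal F_2)$; (vii) $\hat\Phi(\{A\in\mathcal Q(\mathcal T):A\cap\mathcal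 T_+\neq\emptyset\})=\{\overline{\mathbf D}\}$ and $\hat\Phi(\mathcal Q(\mathcal T))=\hat{\mathbf E}_{\mathrm{fin}}$; (viii) $\hat\Delta(\{\overline{\mathbf D}\})=\{A\in\mathcal Q(\mathcal T):A\cap\mathcal T_+\neq\emptyset\}$ and $\hat\Delta(\hat{\mathbf E}_{\mathrm{fin}})=\mathcal Q(\mathcal T)$. Hence $\hat\Phi$ is an order isomorphism between $(\mathbf F_{\mathrm{fin}},\subseteq)$, the set of all finitely coherent SDFSes together with $\mathcal Q(\mathcal T)$, and the set $(\mathbf F(\hat{\mathbf E}_{\mathrm{fin}}),\subseteq)$ of all filters on $\hat{\mathbf E}_{\mathrm{fin}}$, with inverse $\hat\Delta$. Moreover, (ix) if a proper filter $\mathcal F$ and a finitely coherent SDFS $F$ satisfy $\mathcal F=\hat\Phi(F)$ and $F=\hat\Delta(\mathcal F)$, then $\mathcal F$ is a prime filter on $(\hat{\mathbf E}_{\mathrm{fin}},\subseteq)$ if and only if $F$ is complete, i.e. for all finite $A_1,A_2\subseteq\mathcal T$, $A_1\cup A_2\in F$ implies $A_1\in F$ or $A_2\in F$.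
   Context: Let $\mathcal T$ be a non-empty set (of ''things''), $\mathrm{cl}:\mathcal P(\mathcal T)\to\mathcal P(\mathcal T)$ a closure operator (extensive, monotone, idempotent), $\mathcal T_-\subseteq\mathcal T$ a set of forbidden things, $\mathcal T_+:=\mathrm{cl}(\emptyset)$, with standing assumption $\mathcal T_+\cap\mathcal T_-=\emptyset$. A coherent SDT is a $D\subseteq\mathcal T$ with $\mathrm{cl}(D)=D$ and $D\cap\mathcal T_-=\emptyset$; $\overline{\mathbf D}$ is the set of all coherent SDTs. $\mathcal Q(\mathcal T)$ is the set of finite subsets of $\mathcal T$ (including $\emptyset$). For $\mathcal V\subseteq\mathcal Q(\mathcal T)$, $\Sigma_{\mathcal V}$ is the set of maps $\sigma:\mathcal V\to\mathcal T$ with $\sigma(A)\in A$ for all $A\in\mathcal V$, and $\sigma(\mathcal V):=\{\sigma(A):A\in\mathcal V\}$. An SDFS is any $F\subseteq\mathcal Q(\mathcal T)$. It is finitely coherent if (F1) $\emptyset\notin F$; (F2) if $A_1\in F$ and $A_1\subseteq A_2\in\mathcal Q(\mathcal T)$ then $A_2\in F$; (F3) if $A\in F$ then $A\setminus\mathcal T_-\in F$; (F4) $\{t\}\in F$ for all $t\in\mathcal T_+$; (F5) for every non-empty finite $\mathcal V\subseteq F$ and every family $(t_\sigma)_{\sigma\in\Sigma_{\mathcal V}}$ with $t_\sigma\in\mathrm{cl}(\sigma(\mathcal V))$, $\{t_\sigma:\sigma\in\Sigma_{\mathcal V}\}\in F$. For $S\subseteq\mathcal T$ let $\overline{\mathbf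 D}_S:=\{D\in\overline{\mathbf D}:S\cap D\neq\emptyset\}$, for $\mathcal V\subseteq\mathcal P(\mathcal T)$ let $E(\mathcal V):=\bigcap_{A\in\mathcal V}\overline{\mathbf D}_A$ (with $E(\emptyset)=\overline{\mathbf D}$), and $\hat{\mathbf E}_{\mathrm{fin}}:=\{E(\mathcal V):\mathcal V\subseteq\mathcal Q(\mathcal T)\text{ finite}\}$, ordered by inclusion (a bounded distributive lattice with union as join, intersection as meet, bottom $\emptyset$, top $\overline{\mathbf D}$). A filter on a bounded lattice $(L,\le)$ is a non-empty $\mathcal F\subseteq L$ with $a\in\mathcal F,a\le b\Rightarrow b\in\mathcal F$ and $a,b\in\mathcal F\Rightarrow a\wedge b\in\mathcal F$; proper if $\mathcal F\ne L$; prime if proper and $a\vee b\in\mathcal F\Rightarrow(a\in\mathcal F$ or $b\in\mathcal F)$. *)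

(* Defs.v *)
From mathcomp Require Import all_boot.
From mathcomp Require Import boolp classical_sets functions cardinality.

Set Implicit Arguments.
Unset Strict Implicit.
Unset Printing Implicit Defensive.

Local Open Scope classical_set_scope.

Record closure_operator (T : Type) (cl : set T -> set T) : Prop := {
  closure_extensive : forall A, A `<=` cl A;
  closure_monotone : forall A B, A `<=` B -> cl A `<=` cl B;
  closure_idempotent : forall A, cl (cl A) = cl A }.

(* Throughout, [cl] is the closure operator on the things [T] and [Tm] is the
   set of forbidden things. *)

Definition Tplus (T : Type) (cl : set T -> set T) : set T := cl set0.

Definition coherent_SDT (T : Type) (cl : set T -> set T) (Tm D : set T) : Prop :=
  cl D = D /\ D `&` Tm = set0.

Definition Dbar (T : Type) (cl : set T -> set T) (Tm : set T) : set (set T) :=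
  [set D | coherent_SDT cl Tm D].

Definition Q (T : Type) : set (set T) := [set A | finite_set A].
Arguments Q : clear implicits.

Definition SDFS (T : Type) (F : set (set T)) : Prop := F `<=` Q T.

(* The domain of a selection map is the subtype [set_type V], not [set T], so
   that selections are exactly the maps from V to T: there are finitely many
   of them when V is a finite family of finite sets. *)
Definition selections (T : Type) (V : set (set T)) : set (set_type V -> T) :=
  [set s | forall A : set_type V, (sval A) (s A)].

(* In [fin_coherent_F5] only the values of [t] on [selections V] matter, and
   [range s] is the set of things selected by [s]. *)
Record finitely_coherent (T : Type) (cl : set T -> set T) (Tm : set T)
    (F : set (set T)) : Prop := {
  fin_coherent_SDFS : SDFS F;
  fin_coherent_F1 : ~ F set0;
  fin_coherent_F2 : forall A1 A2, F A1 -> A1 `<=` A2 -> Q T A2 -> F A2;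
  fin_coherent_F3 : forall A, F A -> F (A `\` Tm);
  fin_coherent_F4 : forall t, Tplus cl t -> F [set t];
  fin_coherent_F5 : forall V : set (set T),
    V !=set0 -> finite_set V -> V `<=` F ->
    forall t : (set_type V -> T) -> T,
    (forall s, @selections T V s -> cl (range s) (t s)) ->
    F [set t s | s in @selections T V] }.

Definition complete (T : Type) (F : set (set T)) : Prop :=
  forall A1 A2 : set T, finite_set A1 -> finite_set A2 ->
    F (A1 `|` A2) -> F A1 \/ F A2.

Definition Dbar_meet (T : Type) (cl : set T -> set T) (Tm S : set T)
  : set (set T) := [set D | Dbar cl Tm D /\ S `&` D !=set0].

(* Intersecting with [Dbar] only matters for the empty family, where the
   bare intersection would be the set of all subsets of T. *)
Definition E (T : Type) (cl : set T -> set T) (Tm : set T)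
    (V : set (set T)) : set (set T) :=
  Dbar cl Tm `&` \bigcap_(A in V) Dbar_meet cl Tm A.

Definition Efin (T : Type) (cl : set T -> set T) (Tm : set T)
  : set (set (set T)) :=
  [set E cl Tm V | V in [set V | V `<=` Q T /\ finite_set V]].

(* Filters on a lattice L of subsets of X, ordered by inclusion, whose join and
   meet are union and intersection. *)
Record lattice_filter (X : Type) (L Fl : set (set X)) : Prop := {
  lattice_filter_sub : Fl `<=` L;
  lattice_filter_nonempty : Fl !=set0;
  lattice_filter_up : forall a b, Fl a -> L b -> a `<=` b -> Fl b;
  lattice_filter_meet : forall a b, Fl a -> Fl b -> Fl (a `&` b) }.

Definition proper_filter (X : Type) (L Fl : set (set X)) : Prop :=
  lattice_filter L Fl /\ Fl <> L.

Definition prime_filter (X : Type) (L Fl : set (set X)) : Prop :=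
  proper_filter L Fl /\
  forall a b, L a -> L b -> Fl (a `|` b) -> Fl a \/ Fl b.

Definition Phi (T : Type) (cl : set T -> set T) (Tm : set T)
    (F : set (set T)) : set (set (set T)) :=
  [set E cl Tm V | V in [set V | V `<=` F /\ finite_set V]].

Definition Delta (T : Type) (cl : set T -> set T) (Tm : set T)
    (Fl : set (set (set T))) : set (set T) :=
  [set A | Q T A /\ Fl (Dbar_meet cl Tm A)].

Definition Ffin (T : Type) (cl : set T -> set T) (Tm : set T)
  : set (set (set T)) :=
  [set F | finitely_coherent cl Tm F] `|` [set Q T].

Definition filters_Efin (T : Type) (cl : set T -> set T) (Tm : set T)
  : set (set (set (set T))) :=
  [set Fl | lattice_filter (Efin cl Tm) Fl].

Definition order_isomorphism (X Y : Type) (P : set (set X)) (R : set (set Y))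
    (f : set X -> set Y) : Prop :=
  set_bij P R f /\
  forall a b, P a -> P b -> (a `<=` b <-> f a `<=` f b).

Definition inverse_on (X Y : Type) (P : set X) (R : set Y)
    (f : X -> Y) (g : Y -> X) : Prop :=
  [/\ set_fun R P g, forall a, P a -> g (f a) = a &
      forall b, R b -> f (g b) = b].

(* [Efin] is indeed a bounded lattice with the expected operations, and [Phi]
   and [Delta] take values in the expected power sets. *)

Lemma Efin_setI (T : Type) (cl : set T -> set T) (Tm : set T)
    (a b : set (set T)) :
  Efin cl Tm a -> Efin cl Tm b -> Efin cl Tm (a `&` b).
Proof.
move=> [V [VQ finV] <-] [W [WQ finW] <-]; exists (V `|` W).
  by split; [move=> A [/VQ|/WQ] | rewrite finite_setU].
by rewrite /E bigcap_setU setIACA setIid.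
Qed.

Lemma Efin_setU (T : Type) (cl : set T -> set T) (Tm : set T)
    (a b : set (set T)) :
  Efin cl Tm a -> Efin cl Tm b -> Efin cl Tm (a `|` b).
Proof.
move=> [V [VQ finV] <-] [W [WQ finW] <-].
exists [set A `|` B | A in V & B in W].
  split; last exact: finite_image2.
  by move=> _ [A /VQ finA [B /WQ finB <-]]; rewrite /Q /= finite_setU.
apply/seteqP; split=> D.
- move=> [DD DAB]; case: (pselect (E cl Tm V D)) => [|nV]; first by left.
  right; split=> // B WB; split=> //; apply: contrapT => nB.
  apply: nV; split=> // A VA; split=> //.
  have [_ [x [[Ax|Bx] Dx]]] := DAB _ (ex_intro2 _ _ A VA (ex_intro2 _ _ B WB erefl)).
    by exists x.
  by case: nB; exists x.
- move=> [[DD DV]|[DD DW]]; split=> // _ [A VA [B WB <-]]; split=> //.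
    by have [_ [x [Ax Dx]]] := DV _ VA; exists x; split=> //; left.
  by have [_ [x [Bx Dx]]] := DW _ WB; exists x; split=> //; right.
Qed.

Lemma Efin_top (T : Type) (cl : set T -> set T) (Tm : set T) :
  Efin cl Tm (Dbar cl Tm) /\ forall a, Efin cl Tm a -> a `<=` Dbar cl Tm.
Proof.
split; last by move=> _ [V _ <-] D [].
by exists set0; [split; [exact: sub0set | exact: finite_set0]
               | rewrite /E bigcap_set0 setIT].
Qed.

Lemma Efin_bot (T : Type) (cl : set T -> set T) (Tm : set T) :
  Efin cl Tm set0.
Proof.
exists [set set0].
  by split; [move=> _ ->; exact: finite_set0 | exact: finite_set1].
rewrite /E bigcap_set1; apply/seteqP; split=> D //.
by move=> [_ [_ [x [[]]]]].
Qed.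

Lemma Phi_sub (T : Type) (cl : set T -> set T) (Tm : set T) (F : set (set T)) :
  SDFS F -> Phi cl Tm F `<=` Efin cl Tm.
Proof.
by move=> FQ _ [V [VF finV] <-]; exists V => //; split=> // A /VF /FQ.
Qed.

Lemma Delta_sub (T : Type) (cl : set T -> set T) (Tm : set T)
    (Fl : set (set (set T))) : SDFS (Delta cl Tm Fl).
Proof. by move=> A []. Qed.

(* Main.v *)
Require Import Defs.
From mathcomp Require Import all_boot.
From mathcomp Require Import boolp classical_sets functions cardinality.

Local Open Scope classical_set_scope.

(* The crux is that a finitely coherent [F] contains every finite [A] with
   [E V `<=` Dbar_meet A] for some finite [V `<=` F]. Each selection [s] of [V]
   generates the closed set [cl (range s)]: if it avoids [Tm], it is a coherent
   SDT in [E V], hence meets [A]; otherwise it meets [Tm]. Choosing [t s]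
   accordingly, (F5) puts the set of all [t s], a subset of [A `|` Tm], in [F],
   and (F3) and (F2) then give [A]. Conversely, a filter satisfies (F5) because
   any [D] in [E V] contains the range of some selection of [V]. *)

(** This makes the set produced in (F5) finite. With [v] listing [V] and [u] listing its union, [f]
    decodes finite functions from [v] to [u], and every selection arises this way. *)
Lemma finite_selections (T : Type) (V : set (set T)) :
  finite_set V -> V `<=` Q T -> finite_set (@selections T V).
Proof.
move=> finV VQ; have finU : finite_set (\bigcup_(A in V) A) by exact: bigcup_finite.
have [v Vv] := (@finite_seqP {classic set T} V).1 finV.
have [u Uu] := (@finite_seqP {classic T} _).1 finU.
have vP (A : {classic set T}) : V A = (A \in v) by rewrite Vv.
have inv (A : set_type V) : (sval A : {classic set T}) \in v.
  by rewrite -vP; exact: set_valP.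
have Vin (A : seq_sub v) : V (ssval A) by rewrite vP; exact: ssvalP.
pose f (phi : {ffun seq_sub v -> seq_sub u}) (A : set_type V) : T :=
  ssval (phi (SeqSub (inv A))).
apply: (@sub_finite_set _ _ (f @` setT)); last exact/finite_image/finite_finset.
move=> s sV.
have sin (A : set_type V) : (s A : {classic T}) \in u.
  have : (\bigcup_(A in V) A) (s A).
    by exists (sval A); [exact: set_valP | exact: sV].
  by rewrite Uu.
exists [ffun A => SeqSub (sin (SigSub (mem_set (Vin A))))] => //.
(* Passing through [v] changes only the membership proof carried by [A]. *)
by apply/funext => A; rewrite /f ffunE /=; congr s; exact: val_inj.
Qed.

Section Representation.
Set Implicit Arguments.
Unset Strict Implicit.

Variables (T : Type) (cl : set T -> set T) (cl_closure : closure_operator cl).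
Variables (Tm : set T) (Tplus_Tm : Tplus cl `&` Tm = set0).

Local Notation D_ := (Dbar_meet cl Tm).
Local Notation Dbar := (Dbar cl Tm).
Local Notation E := (E cl Tm).
Local Notation Efin := (Efin cl Tm).
Local Notation Phi := (Phi cl Tm).
Local Notation Delta := (Delta cl Tm).

(** * Coherent SDTs meeting given sets *)

Lemma Dbar_Tplus : Dbar (Tplus cl).
Proof. by split=> //; exact: closure_idempotent. Qed.

Lemma Tplus_sub_Dbar (D : set T) : Dbar D -> Tplus cl `<=` D.
Proof. by move=> [<- _]; apply: closure_monotone => //; exact: sub0set. Qed.

Lemma E_set0 : E set0 = Dbar.
Proof. by rewrite /Defs.E bigcap_set0 setIT. Qed.

Lemma E_set1 (A : set T) : E [set A] = D_ A.
Proof. by rewrite /Defs.E bigcap_set1; apply/setIidPr => D []. Qed.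

Lemma E_setU (V W : set (set T)) : E (V `|` W) = E V `&` E W.
Proof. by rewrite /Defs.E bigcap_setU setIACA setIid. Qed.

Lemma E_sub (V : set (set T)) (A : set T) : V A -> E V `<=` D_ A.
Proof. by move=> VA D [_]; apply. Qed.

Lemma Efin_Dbar_meet (A : set T) : Q T A -> Efin (D_ A).
Proof.
move=> finA; rewrite -E_set1; exists [set A] => //.
by split; [move=> _ -> | exact: finite_set1].
Qed.

Lemma Dbar_meet0 : D_ set0 = set0.
Proof. by apply/seteqP; split=> D // [_ [x []]]. Qed.

Lemma Dbar_meetU (A B : set T) : D_ (A `|` B) = D_ A `|` D_ B.
Proof.
apply/seteqP; split=> D.
  by move=> [DD [x [[Ax|Bx] Dx]]]; [left|right]; split=> //; exists x.
by move=> [[DD [x [Ax Dx]]]|[DD [x [Bx Dx]]]]; split=> //; exists x; split=> //;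
  [left|right].
Qed.

Lemma Dbar_meetS (A B : set T) : A `<=` B -> D_ A `<=` D_ B.
Proof. by move=> AB D [DD [x [/AB Bx Dx]]]; split=> //; exists x. Qed.

(** Coherent SDTs contain no forbidden things; this is what (F3) reflects. *)
Lemma Dbar_meetD (A : set T) : D_ (A `\` Tm) = D_ A.
Proof.
apply/seteqP; split; first by apply: Dbar_meetS => x [].
move=> D [[clD DTm] [x [Ax Dx]]]; split=> //; exists x; split=> //; split=> // Tmx.
by have : (D `&` Tm) x by []; rewrite DTm.
Qed.

(** By the standing assumption, [Tplus cl] is the least coherent SDT, so it is enough to test it
    alone. *)
Lemma Dbar_meet_eq_Dbar (A : set T) : D_ A = Dbar <-> A `&` Tplus cl !=set0.
Proof.
split=> [DA|[x [Ax Tx]]].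
  by have := Dbar_Tplus; rewrite -DA => -[].
apply/seteqP; split=> D; first by case.
by move=> DD; split=> //; exists x; split=> //; exact: Tplus_sub_Dbar Tx.
Qed.

Lemma fin_coherent_sup (F V : set (set T)) (A : set T) :
  finitely_coherent cl Tm F -> V `<=` F -> finite_set V -> Q T A ->
  E V `<=` D_ A -> F A.
Proof.
move=> cF VF finV finA VA.
(* (F5) only covers non-empty families. For the empty one, [Tplus cl] itself must meet [A], and (F4)
   with (F2) suffice. *)
have [V0|/set0P[B0 VB0]] := eqVneq V set0.
  have [_ [x [Ax Tx]]] : D_ A (Tplus cl).
    by apply: VA; rewrite V0 E_set0; exact: Dbar_Tplus.
  by apply: (fin_coherent_F2 cF (fin_coherent_F4 cF Tx)) => // _ ->.
have /choice[t tP] (s : set_type V -> T) :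
    exists x, @selections T V s -> cl (range s) x /\ (A `|` Tm) x.
  have [sV|] := pselect (@selections T V s); last first.
    (* An arbitrary value: nothing is required of [t] outside the selections. *)
    by exists (s (SigSub (mem_set VB0))).
  have [sTm|/set0P[x [sx Tmx]]] := eqVneq (cl (range s) `&` Tm) set0; last first.
    by exists x => _; split=> //; right.
  have [_ [x [Ax sx]]] : D_ A (cl (range s)).
    have Ds : Dbar (cl (range s)) by split=> //; exact: closure_idempotent.
    (* The closed set meets each [B] in [V] at the thing that [s] selects from [B]. *)
    apply: VA; split=> // B VB; split=> //.
    exists (s (SigSub (mem_set VB))); split; first exact: (sV (SigSub (mem_set VB))).
    by apply: closure_extensive => //; exists (SigSub (mem_set VB)).
  by exists x => _; split=> //; left.
have Ft : F [set t s | s in @selections T V].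
  by apply: (fin_coherent_F5 cF) => //; [exists B0 | move=> s /tP[]].
apply: (fin_coherent_F2 cF (fin_coherent_F3 cF Ft)) => //.
by move=> _ [[s /tP[_ Ats] <-] nTm]; case: Ats.
Qed.

(** * Filters on the lattice of events *)

Lemma lattice_filter_top (Fl : set (set (set T))) :
  lattice_filter Efin Fl -> Fl Dbar.
Proof.
move=> fFl; have [a Fla] := lattice_filter_nonempty fFl.
have [Etop aD] := Efin_top cl Tm.
exact: (lattice_filter_up fFl Fla Etop (aD _ (lattice_filter_sub fFl Fla))).
Qed.

(** [E V] is a finite meet of the [D_ A], built up along a list of [V] starting from the top. Hence
    a filter is determined by the [D_ A] it contains, that is, by its image under [Delta]. *)
Lemma lattice_filter_E (Fl : set (set (set T))) (V : set (set T)) :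
  lattice_filter Efin Fl -> finite_set V -> V `<=` Q T ->
  Fl (E V) <-> (forall A, V A -> Fl (D_ A)).
Proof.
move=> fFl finV VQ; split=> [FlV A VA|].
  exact: (lattice_filter_up fFl FlV (Efin_Dbar_meet (VQ _ VA)) (E_sub VA)).
have [v Vv] := (@finite_seqP {classic set T} V).1 finV.
rewrite {}Vv {finV} in VQ *; elim: v VQ => [|A v IH] VQ FlV.
  by rewrite set_nil E_set0; exact: lattice_filter_top.
have -> : [set` A :: v] = [set A] `|` [set` v].
  apply/seteqP; split=> B /=; rewrite inE; first by move=> /predU1P.
  by move=> ?; apply/predU1P.
rewrite E_setU E_set1; apply: (lattice_filter_meet fFl).
  by apply: FlV; rewrite /= inE eqxx.
by apply: IH => B Bv; [apply: VQ|apply: FlV]; rewrite /= inE Bv orbT.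
Qed.

Lemma lattice_filter_full (Fl : set (set (set T))) :
  lattice_filter Efin Fl -> Fl set0 -> Fl = Efin.
Proof.
move=> fFl Fl0; apply/seteqP; split; first exact: lattice_filter_sub.
by move=> a La; exact: (lattice_filter_up fFl Fl0 La (@sub0set _ _)).
Qed.

(** * Monotonicity and extreme values of the two maps *)

Lemma PhiS (F1 F2 : set (set T)) : F1 `<=` F2 -> Phi F1 `<=` Phi F2.
Proof.
by move=> F12 _ [V [VF finV] <-]; exists V => //; split=> // A /VF /F12.
Qed.

Lemma DeltaS (Fl1 Fl2 : set (set (set T))) :
  Fl1 `<=` Fl2 -> Delta Fl1 `<=` Delta Fl2.
Proof. by move=> Fl12 A [finA /Fl12]. Qed.

Lemma Phi_Q : Phi (Q T) = Efin. Proof. by []. Qed.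

Lemma Delta_Efin : Delta Efin = Q T.
Proof.
by apply/seteqP; split=> A; [case | move=> finA; split=> //; exact: Efin_Dbar_meet].
Qed.

Lemma Phi_Tplus :
  Phi [set A | Q T A /\ A `&` Tplus cl !=set0] = [set Dbar].
Proof.
apply/seteqP; split=> [_ [V [VT _] <-]|_ ->].
  apply/seteqP; split=> D; first by case.
  by move=> DD; split=> // A /VT[_ /Dbar_meet_eq_Dbar ->].
by exists set0; [split; [exact: sub0set | exact: finite_set0] | exact: E_set0].
Qed.

Lemma Delta_Dbar :
  Delta [set Dbar] = [set A | Q T A /\ A `&` Tplus cl !=set0].
Proof.
by apply/seteqP; split=> A [finA /Dbar_meet_eq_Dbar].
Qed.

(** * The correspondence between finitely coherent SDFSes and filters *)

Lemma Phi_proper_filter (F : set (set T)) :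
  finitely_coherent cl Tm F -> proper_filter Efin (Phi F).
Proof.
move=> cF; split; first split.
- exact/Phi_sub/(fin_coherent_SDFS cF).
- by exists (E set0), set0 => //; split; [exact: sub0set | exact: finite_set0].
(* The larger event [E W] needs no new representation: each [A] in [W] satisfies [E V]<=[D_ A],
   which already forces [A] into [F]. *)
- move=> _ _ [V [VF finV] <-] [W [WQ finW] <-] VW; exists W => //; split=> // A WA.
  apply: (fin_coherent_sup cF VF finV (WQ _ WA)).
  by apply: (subset_trans VW); exact: E_sub.
- move=> _ _ [V [VF finV] <-] [W [WF finW] <-]; exists (V `|` W); last exact: E_setU.
  by split; [rewrite subUset | rewrite finite_setU].
(* If the bottom were some [E V] with [V]<=[F], the empty set would be forced into [F], against
   (F1). *)
- move=> PhiF; have := Efin_bot cl Tm; rewrite -PhiF => -[V [VF finV] EV0].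
  apply: (fin_coherent_F1 cF); apply: (fin_coherent_sup cF VF finV).
    exact: finite_set0.
  by rewrite EV0; exact: sub0set.
Qed.

Lemma Delta_finitely_coherent (Fl : set (set (set T))) :
  proper_filter Efin Fl -> finitely_coherent cl Tm (Delta Fl).
Proof.
move=> [fFl FlL]; split.
- exact: Delta_sub.
- by move=> [_]; rewrite Dbar_meet0 => /(lattice_filter_full fFl).
- move=> A B [_ FlA] AB finB; split=> //.
  exact: (lattice_filter_up fFl FlA (Efin_Dbar_meet finB) (Dbar_meetS AB)).
- by move=> A [finA FlA]; split; [exact: finite_setD | rewrite Dbar_meetD].
- move=> x Tx; split; first exact: finite_set1.
  have -> : D_ [set x] = Dbar by apply/Dbar_meet_eq_Dbar; exists x.
  exact: lattice_filter_top.
- move=> V _ finV VF t tP.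
  have VQ : V `<=` Q T by move=> A /VF[].
  have finI : Q T [set t s | s in @selections T V].
    exact/finite_image/finite_selections.
  split=> //; apply: (lattice_filter_up fFl _ (Efin_Dbar_meet finI)).
    by apply/(lattice_filter_E fFl finV VQ) => A /VF[].
  move=> D [DD DV]; split=> //.
  (* Selecting only things in [D] gives [range s]<=[D]; as [D] is closed, it then contains [t s]. *)
  have /choice[s sP] (A : set_type V) : exists x, sval A x /\ D x.
    by have [_ [x [Ax Dx]]] := DV _ (set_valP A); exists x.
  have sV : @selections T V s by move=> A; have [] := sP A.
  exists (t s); split; first by exists s.
  case: DD => <- _; apply: (closure_monotone cl_closure _ (tP _ sV)).
  by move=> _ [A _ <-]; have [] := sP A.
Qed.

Lemma PhiK (F : set (set T)) : finitely_coherent cl Tm F -> Delta (Phi F) = F.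
Proof.
move=> cF; apply/seteqP; split=> A.
  move=> [finA [V [VF finV] EV]]; apply: (fin_coherent_sup cF VF finV finA).
  by rewrite EV.
move=> FA; split; first exact: (fin_coherent_SDFS cF).
by exists [set A]; [split; [move=> _ -> | exact: finite_set1] | exact: E_set1].
Qed.

(** Properness is not assumed, so that the isomorphism can also cover the improper filter [Efin],
    which is matched with [Q T]. *)
Lemma DeltaK (Fl : set (set (set T))) :
  lattice_filter Efin Fl -> Phi (Delta Fl) = Fl.
Proof.
move=> fFl; apply/seteqP; split=> [_ [V [VD finV] <-]|a Fla].
  have VQ : V `<=` Q T by move=> A /VD[].
  by apply/(lattice_filter_E fFl finV VQ) => A /VD[].
have [V [VQ finV] Va] := lattice_filter_sub fFl Fla.
exists V => //; split=> // A VA; split; first exact: VQ.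
by move: A VA; apply/(lattice_filter_E fFl finV VQ); rewrite Va.
Qed.

Lemma lattice_filter_Efin : lattice_filter Efin Efin.
Proof.
by split=> //; [exists set0; exact: Efin_bot | move=> a b; exact: Efin_setI].
Qed.

Lemma Phi_filters (F : set (set T)) : Ffin cl Tm F -> filters_Efin cl Tm (Phi F).
Proof.
by move=> [/Phi_proper_filter[]|->] //; rewrite Phi_Q; exact: lattice_filter_Efin.
Qed.

Lemma Delta_Ffin (Fl : set (set (set T))) :
  filters_Efin cl Tm Fl -> Ffin cl Tm (Delta Fl).
Proof.
move=> fFl; have [->|FlL] := pselect (Fl = Efin).
  by right; exact: Delta_Efin.
by left; exact: Delta_finitely_coherent.
Qed.

Lemma Ffin_PhiK (F : set (set T)) : Ffin cl Tm F -> Delta (Phi F) = F.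
Proof. by move=> [/PhiK|->] //; rewrite Phi_Q; exact: Delta_Efin. Qed.

Lemma Phi_order_isomorphism :
  order_isomorphism (Ffin cl Tm) (filters_Efin cl Tm) Phi.
Proof.
split; first split.
- exact: Phi_filters.
- by move=> F G /set_mem/Ffin_PhiK FK /set_mem/Ffin_PhiK GK FG; rewrite -FK FG.
- by move=> Fl fFl; exists (Delta Fl); [exact: Delta_Ffin | exact: DeltaK].
(* [Phi] reflects inclusion because its left inverse [Delta] is monotone. *)
- move=> F G /Ffin_PhiK FK /Ffin_PhiK GK; split; first exact: PhiS.
  by move=> /DeltaS; rewrite FK GK.
Qed.

(** [D_] turns unions into joins, so primeness restricted to the generators [D_ A] is completeness.
    It extends to all events, since an event [E V] outside the filter lies below some [D_ A] outside
    it, with [A] in [V]. *)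
Lemma prime_filter_complete (Fl : set (set (set T))) :
  proper_filter Efin Fl -> (prime_filter Efin Fl <-> complete (Delta Fl)).
Proof.
move=> pFl; have [fFl _] := pFl; split.
  move=> [_ prFl] A B finA finB [_]; rewrite Dbar_meetU.
  by move=> /prFl[| |FlA|FlB]; [exact: Efin_Dbar_meet..|left|right].
move=> cFl; split=> // _ _ [V [VQ finV] <-] [W [WQ finW] <-] FlVW.
apply: contrapT => /not_orP[].
move=> /(contra_not (proj2 (lattice_filter_E fFl finV VQ))).
move=> /existsNP[A /not_implyP[VA nA]].
move=> /(contra_not (proj2 (lattice_filter_E fFl finW WQ))).
move=> /existsNP[B /not_implyP[WB nB]].
have finAB : Q T (A `|` B) by rewrite /Q /= finite_setU; split; [exact: VQ | exact: WQ].
(* [E V] and [E W] lie below [D_ A] and [D_ B], so their join lies below [D_ (A]|[B)]. *)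
have : Delta Fl (A `|` B).
  split=> //; apply: (lattice_filter_up fFl FlVW (Efin_Dbar_meet finAB)).
  by rewrite Dbar_meetU; apply: setUSS; exact: E_sub.
by move=> /(cFl _ _ (VQ _ VA) (WQ _ WB))[[]|[]].
Qed.

End Representation.

Theorem theorem11 (T : Type) (T_nonempty : [set: T] !=set0)
    (cl : set T -> set T) (cl_closure : closure_operator cl)
    (Tm : set T) (Tplus_Tm : Tplus cl `&` Tm = set0) :
  (* (i) *)
  (forall F : set (set T), finitely_coherent cl Tm F ->
     proper_filter (Efin cl Tm) (Phi cl Tm F)) /\
  (* (ii) *)
  (forall Fl : set (set (set T)), proper_filter (Efin cl Tm) Fl ->
     finitely_coherent cl Tm (Delta cl Tm Fl)) /\
  (* (iii) *)
  (forall F : set (set T), finitely_coherent cl Tm F ->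
     Delta cl Tm (Phi cl Tm F) = F) /\
  (* (iv) *)
  (forall Fl : set (set (set T)), proper_filter (Efin cl Tm) Fl ->
     Phi cl Tm (Delta cl Tm Fl) = Fl) /\
  (* (v) *)
  (forall F1 F2 : set (set T), SDFS F1 -> SDFS F2 ->
     F1 `<=` F2 -> Phi cl Tm F1 `<=` Phi cl Tm F2) /\
  (* (vi) *)
  (forall Fl1 Fl2 : set (set (set T)),
     Fl1 `<=` Efin cl Tm -> Fl2 `<=` Efin cl Tm ->
     Fl1 `<=` Fl2 -> Delta cl Tm Fl1 `<=` Delta cl Tm Fl2) /\
  (* (vii) *)
  (Phi cl Tm [set A | Q T A /\ A `&` Tplus cl !=set0] = [set Dbar cl Tm] /\
   Phi cl Tm (Q T) = Efin cl Tm) /\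
  (* (viii) *)
  (Delta cl Tm [set Dbar cl Tm] = [set A | Q T A /\ A `&` Tplus cl !=set0] /\
   Delta cl Tm (Efin cl Tm) = Q T) /\
  (* order isomorphism *)
  (order_isomorphism (Ffin cl Tm) (filters_Efin cl Tm) (Phi cl Tm) /\
   inverse_on (Ffin cl Tm) (filters_Efin cl Tm) (Phi cl Tm) (Delta cl Tm)) /\
  (* (ix) *)
  (forall (Fl : set (set (set T))) (F : set (set T)),
     proper_filter (Efin cl Tm) Fl -> finitely_coherent cl Tm F ->
     Fl = Phi cl Tm F -> F = Delta cl Tm Fl ->
     (prime_filter (Efin cl Tm) Fl <-> complete F)).
Proof.
split; first by move=> F; exact: Phi_proper_filter.
split; first by move=> Fl; exact: Delta_finitely_coherent.
split; first by move=> F; exact: PhiK.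
split; first by move=> Fl [fFl _]; exact: DeltaK.
split; first by move=> F1 F2 _ _; exact: PhiS.
split; first by move=> Fl1 Fl2 _ _; exact: DeltaS.
split; first by split; [exact: Phi_Tplus | exact: Phi_Q].
split; first by split; [exact: Delta_Dbar | exact: Delta_Efin].
split.
  split; first exact: Phi_order_isomorphism.
  split; [exact: Delta_Ffin | exact: Ffin_PhiK | exact: DeltaK].
by move=> Fl F pFl _ _ ->; exact: prime_filter_complete.
Qed.
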